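(* Let $(\mathbf{C},\mathcal M)$ be an $\mathcal M$-adhesive category with a unique $\mathcal E'$–$\mathcal M$ pair factorization and binary coproducts, such that the corresponding plain system has initial transformation pairs for conflicts. Then for any rules $\rho_1=\langle p_1,ac_{L_1}\rangle$, $\rho_2=\langle p_2,ac_{L_2}\rangle$, the set of initial conflicts for $\langle\rho_1,\rho_2\rangle$ is complete with respect to parallel dependence: for every parallel dependent pair of direct transformations $H_1\Leftarrow_{\rho_1,m_1}G\Rightarrow_{\rho_2,m_2}H_2$ there is an initial conflict $stp_K=\langle tp_K,ac_K,ac^*_K\rangle$ and a morphism $m\colon K\to G$ with $m\models ac_K\wedge ac^*_K$ via which $tp_K$ can be embedded into the given pair by extension diagrams.
   Context: $\mathcal M$-adhesive category: category with a distinguished class $\mathcal M$ of monomorphisms satisfying the standard axioms (including the van Kampen property). Unique $\mathcal E'$–$\mathcal M$ pair factorization: every pair $f_1\colon A_1\to B$, $f_2\colon A_2\to B$ factors uniquely up to isomorphism as $f_j=m\circ e_j$ with $(e_1,e_2)\in\mathcal E'$, $m\in\mathcal M$. ACs over $P$: $\exists(a,ac_C)$ for $a\colon P\to C$ and an AC $ac_C$ over $C$; negations and finite conjunctions (empty conjunction $=\mathrm{true}$; $\mathrm{false}=\neg\mathrm{true}$). $p\colon P\to G$ satisfies $\exists(a,ac_C)$ iff there is $q\colon C\to G$ in $\mathcal M$ with $q\circ a=p$ and $q\models ac_C$. $\mathrm{Shift}(b,ac_P)$ for $b\colon P\to P'$ denotes an AC over $P'$ with $n\models\mathrm{Shift}(b,ac_P)\iff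 n\circ b\models ac_P$ for all $n$. For a span $p^*=(K\leftarrow D\rightarrow P)$ of $\mathcal M$-morphisms and AC $ac_P$ over $P$, $\mathrm{Left}(p^*,ac_P)$ denotes an AC over $K$ such that for every double pushout transformation via $p^*$ with match $m$ and comatch $m^*$, $m\models\mathrm{Left}(p^*,ac_P)\iff m^*\models ac_P$. Rule $\rho=\langle p,ac_L\rangle$: plain rule $p=(L\leftarrow I\rightarrow R)$ with $\mathcal M$-morphisms and an AC over $L$. AC-disregarding direct transformation: double pushout for $p$ with match $m$ (intermediate $D$, $k\colon D\to G$, $c\colon D\to H$); direct transformation: additionally $m\models ac_L$. A pair $H_1\Leftarrow_{\rho_1,m_1}G\Rightarrow_{\rho_2,m_2}H_2$ is parallel independent if there are $d_{12}\colon L_1\to D_2$ with $k_2\circ d_{12}=m_1$, $c_2\circ d_{12}\models ac_{L_1}$, and $d_{21}\colon L_2\to D_1$ with $k_1\circ d_{21}=m_2$, $c_1\circ d_{21}\models ac_{L_2}$ (for plain rules, without AC requirements); else parallel dependent (a conflict). Embedding via extension morphism $m\colon K\to G$: $m_j=m\circ o_j$ and the double pushout diagrams are connected by morphisms forming commuting pushout squares (extension diagrams). Symbolic transformation pair $stp_K=\langle tp_K,ac_K,ac^*_K\rangle$: $tp_K\colon P_1\Leftarrow_{\rho_1,o_1}K\Rightarrow_{\rho_2,o_2}P_2$ a pair of AC-disregarding transformations with spans $p^*_j=(K\xleftarrow{k_j}D_j\xrightarrow{c_j}P_j)$; $ac_K=\mathrm{Shift}(o_1,ac_{L_1})\wedge\mathrm{Shift}(o_2,ac_{L_2})$;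 $ac^*_K=\neg(ac^*_{K,d_{12}}\wedge ac^*_{K,d_{21}})$ with $ac^*_{K,d_{12}}=\mathrm{Left}(p^*_2,\mathrm{Shift}(c_2\circ d_{12},ac_{L_1}))$ if some $d_{12}$ with $k_2\circ d_{12}=o_1$ exists and $\mathrm{false}$ otherwise, symmetrically $ac^*_{K,d_{21}}=\mathrm{Left}(p^*_1,\mathrm{Shift}(c_1\circ d_{21},ac_{L_2}))$ or $\mathrm{false}$. Unfolding of $stp_K$: all pairs of direct transformations into which $tp_K$ embeds via some extension morphism; $stp_K$ is conflict-inducing if its unfolding contains a parallel dependent pair. Plain initial transformation pair: $tp^I$ is initial for plain $tp$ if it embeds into $tp$ via $f^I$ and for every $tp'$ embedding into $tp$ via $f$ there is a unique embedding $f'^I$ of $tp^I$ into $tp'$ with $f\circ f'^I=f^I$. The system has initial transformation pairs for conflicts if every conflicting plain pair has one; a plain initial conflict is a conflicting plain pair isomorphic to its initial transformation pair. $tp_{L_1+L_2}\colon R_1+L_2\Leftarrow_{p_1,i_1}L_1+L_2\Rightarrow_{p_2,i_2}L_1+R_2$ (coproduct injections $i_j$) is the initial parallel independent transformation pair. Initial conflict for $\langle\rho_1,\rho_2\rangle$: a conflict-inducing symbolic transformation pair whose AC-disregarding pair is either a plain initial conflict for $p_1,p_2$ or (isomorphic to) $tp_{L_1+L_2}$. *)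

(* Defs.v *)
From mathcomp Require Import ssreflect ssrfun ssrbool seq.
From Stdlib Require Import ClassicalEpsilon.

Set Implicit Arguments.
Unset Strict Implicit.
Unset Printing Implicit Defensive.

(** * Categories *)

Record category := Category {
  ob :> Type;
  hom : ob -> ob -> Type;
  idm : forall A, hom A A;
  comp : forall A B D, hom B D -> hom A B -> hom A D;
  comp_idl : forall A B (f : hom A B), comp (idm B) f = f;
  comp_idr : forall A B (f : hom A B), comp f (idm A) = f;
  comp_assoc : forall A B D E (h : hom D E) (g : hom B D) (f : hom A B),
    comp h (comp g f) = comp (comp h g) f }.

Arguments hom {c} _ _.
Arguments idm {c} _.
Arguments comp {c A B D} _ _.

Declare Scope cat_scope.
Delimit Scope cat_scope with cat.
Notation "g ∘ f" := (comp g f) (at level 40, left associativity) : cat_scope.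
Local Open Scope cat_scope.

Definition mor_class (C : category) := forall A B : C, hom A B -> Prop.

Section Diagrams.
Variable C : category.

Definition is_mono (A B : C) (f : hom A B) : Prop :=
  forall X (g h : hom X A), f ∘ g = f ∘ h -> g = h.

Definition is_iso (A B : C) (f : hom A B) : Prop :=
  exists g : hom B A, g ∘ f = idm A /\ f ∘ g = idm B.

(** Squares are listed as
<<
        A --f--> B
        |        |
        g        h
        v        v
        D --k--> E
>>
*)
Definition is_pushout (A B D E : C) (f : hom A B) (g : hom A D)
    (h : hom B E) (k : hom D E) : Prop :=
  h ∘ f = k ∘ g /\
  forall X (u : hom B X) (v : hom D X), u ∘ f = v ∘ g ->
    exists! w : hom E X, w ∘ h = u /\ w ∘ k = v.

Definition is_pullback (A B D E : C) (f : hom A B) (g : hom A D)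
    (h : hom B E) (k : hom D E) : Prop :=
  h ∘ f = k ∘ g /\
  forall X (u : hom X B) (v : hom X D), h ∘ u = k ∘ v ->
    exists! w : hom X A, f ∘ w = u /\ g ∘ w = v.

End Diagrams.

Record binary_coproducts (C : category) := BinaryCoproducts {
  csum : C -> C -> C;
  cinl : forall A B, hom A (csum A B);
  cinr : forall A B, hom B (csum A B);
  copair : forall A B X, hom A X -> hom B X -> hom (csum A B) X;
  copair_inl : forall A B X (u : hom A X) (v : hom B X),
    copair u v ∘ cinl A B = u;
  copair_inr : forall A B X (u : hom A X) (v : hom B X),
    copair u v ∘ cinr A B = v;
  copair_uniq : forall A B X (w : hom (csum A B) X),
    w = copair (w ∘ cinl A B) (w ∘ cinr A B) }.

Arguments csum {C} _ _ _.
Arguments cinl {C} _ _ _.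
Arguments cinr {C} _ _ _.
Arguments copair {C} _ {A B X} _ _.

(** * [M]-adhesive categories *)

(** The cube has the square [m, f, g, n] as bottom face, [m', f', g', n'] as
    top face and [a, b, c, d] as vertical morphisms; the back faces are those
    containing [a]. *)
Definition is_M_van_kampen (C : category) (inM : mor_class C) (A B D E : C)
    (m : hom A B) (f : hom A D) (g : hom B E) (n : hom D E) : Prop :=
  forall (A' B' D' E' : C)
    (m' : hom A' B') (f' : hom A' D') (g' : hom B' E') (n' : hom D' E')
    (a : hom A' A) (b : hom B' B) (c : hom D' D) (d : hom E' E),
    inM _ _ b -> inM _ _ c -> inM _ _ d ->
    g' ∘ m' = n' ∘ f' -> d ∘ g' = g ∘ b -> d ∘ n' = n ∘ c ->
    is_pullback m' a b m -> is_pullback f' a c f ->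
    (is_pushout m' f' g' n' <-> is_pullback g' b d g /\ is_pullback n' c d n).

Record is_M_adhesive (C : category) (inM : mor_class C) : Prop := {
  M_mono : forall (A B : C) (f : hom A B), inM _ _ f -> is_mono f;
  M_iso : forall (A B : C) (f : hom A B), is_iso f -> inM _ _ f;
  M_comp : forall (A B D : C) (g : hom B D) (f : hom A B),
    inM _ _ g -> inM _ _ f -> inM _ _ (g ∘ f);
  M_decomp : forall (A B D : C) (g : hom B D) (f : hom A B),
    inM _ _ (g ∘ f) -> inM _ _ g -> inM _ _ f;
  M_has_pushout : forall (A B D : C) (m : hom A B) (f : hom A D),
    inM _ _ m -> exists E (g : hom B E) (n : hom D E), is_pushout m f g n;
  M_has_pullback : forall (B D E : C) (g : hom B E) (n : hom D E),
    inM _ _ n -> exists A (m : hom A B) (f : hom A D), is_pullback m f g n;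
  M_pushout : forall (A B D E : C)
    (m : hom A B) (f : hom A D) (g : hom B E) (n : hom D E),
    is_pushout m f g n -> inM _ _ m -> inM _ _ n;
  M_pullback : forall (A B D E : C)
    (m : hom A B) (f : hom A D) (g : hom B E) (n : hom D E),
    is_pullback m f g n -> inM _ _ n -> inM _ _ m;
  M_van_kampen : forall (A B D E : C)
    (m : hom A B) (f : hom A D) (g : hom B E) (n : hom D E),
    is_pushout m f g n -> inM _ _ m -> is_M_van_kampen inM m f g n }.

Record m_adhesive_category := MAdhesiveCategory {
  m_category :> category;
  in_M : mor_class m_category;
  m_adhesive : is_M_adhesive in_M }.

Arguments in_M {m} [A B] _.

(** * Pair factorization *)

Definition pair_class (C : category) :=
  forall A1 A2 B : C, hom A1 B -> hom A2 B -> Prop.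

Definition is_pair_factorization (C : m_adhesive_category) (E' : pair_class C)
    (A1 A2 B K : C) (f1 : hom A1 B) (f2 : hom A2 B)
    (e1 : hom A1 K) (e2 : hom A2 K) (m : hom K B) : Prop :=
  [/\ E' _ _ _ e1 e2, in_M m, m ∘ e1 = f1 & m ∘ e2 = f2].

Definition has_unique_pair_factorization (C : m_adhesive_category)
    (E' : pair_class C) : Prop :=
  forall (A1 A2 B : C) (f1 : hom A1 B) (f2 : hom A2 B),
    (exists K (e1 : hom A1 K) (e2 : hom A2 K) (m : hom K B),
       is_pair_factorization E' f1 f2 e1 e2 m) /\
    forall K (e1 : hom A1 K) (e2 : hom A2 K) (m : hom K B)
           K' (e1' : hom A1 K') (e2' : hom A2 K') (m' : hom K' B),
      is_pair_factorization E' f1 f2 e1 e2 m ->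
      is_pair_factorization E' f1 f2 e1' e2' m' ->
      exists i : hom K K',
        [/\ is_iso i, i ∘ e1 = e1', i ∘ e2 = e2' & m' ∘ i = m].

(** * Nested application conditions *)

Inductive AC (C : category) : C -> Type :=
| ac_exists (P Q : C) (a : hom P Q) (ac : AC Q) : AC P
| ac_not (P : C) (ac : AC P) : AC P
| ac_conj (P : C) (acs : seq (AC P)) : AC P.

Definition ac_true (C : category) (P : C) : AC P := ac_conj [::].
Definition ac_false (C : category) (P : C) : AC P := ac_not (ac_true P).
Definition ac_and (C : category) (P : C) (ac1 ac2 : AC P) : AC P :=
  ac_conj [:: ac1; ac2].

Fixpoint sat (C : m_adhesive_category) (P : C) (ac : AC P) {struct ac} :
    forall G : C, hom P G -> Prop :=
  match ac in AC P return forall G : C, hom P G -> Prop with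
  | ac_exists P Q a ac' => fun G p =>
      exists q : hom Q G, [/\ in_M q, q ∘ a = p & sat ac' q]
  | ac_not P ac' => fun G p => ~ sat ac' p
  | ac_conj P acs => fun G p =>
      foldr (fun ac' Phi => sat ac' p /\ Phi) True acs
  end.

(** * Rules and double pushout transformations *)

(** Spans of [M]-morphisms; they serve both as plain rules and as the spans
    along which application conditions are translated. *)
Record plain_rule (C : m_adhesive_category) := PlainRule {
  lhs : C;
  interface : C;
  rhs : C;
  lmor : hom interface lhs;
  rmor : hom interface rhs;
  lmor_M : in_M lmor;
  rmor_M : in_M rmor }.

Record rule (C : m_adhesive_category) := Rule {
  plain :> plain_rule C;
  rule_ac : AC (lhs plain) }.

Record transformation (C : m_adhesive_category) (p : plain_rule C) (G : C) :=
  Transformation {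
  ctx : C;
  result : C;
  match_mor : hom (lhs p) G;
  comatch : hom (rhs p) result;
  ctx_emb : hom (interface p) ctx;
  kmor : hom ctx G;
  cmor : hom ctx result;
  left_po : is_pushout (lmor p) ctx_emb match_mor kmor;
  right_po : is_pushout (rmor p) ctx_emb comatch cmor }.

Section DerivedSpan.
Variables (C : m_adhesive_category) (p : plain_rule C) (G : C).
Variable t : transformation p G.

Lemma kmor_M : in_M (kmor t).
Proof.
exact: M_pushout (m_adhesive C) _ _ _ _ _ _ _ _ (left_po t) (lmor_M p).
Qed.

Lemma cmor_M : in_M (cmor t).
Proof.
exact: M_pushout (m_adhesive C) _ _ _ _ _ _ _ _ (right_po t) (rmor_M p).
Qed.

Definition derived_span : plain_rule C := PlainRule kmor_M cmor_M.

End DerivedSpan.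

Definition is_direct (C : m_adhesive_category) (r : rule C) (G : C)
    (t : transformation r G) : Prop := sat (rule_ac r) (match_mor t).

Record transformation_pair (C : m_adhesive_category) (p1 p2 : plain_rule C) :=
  TransformationPair {
  source : C;
  trafo1 : transformation p1 source;
  trafo2 : transformation p2 source }.

Section Pairs.
Variable C : m_adhesive_category.

Definition is_direct_pair (r1 r2 : rule C) (tp : transformation_pair r1 r2) :
  Prop := is_direct (trafo1 tp) /\ is_direct (trafo2 tp).

Definition plain_parallel_independent (p1 p2 : plain_rule C)
    (tp : transformation_pair p1 p2) : Prop :=
  let t1 := trafo1 tp in let t2 := trafo2 tp in
  (exists d12 : hom (lhs p1) (ctx t2), kmor t2 ∘ d12 = match_mor t1) /\
  (exists d21 : hom (lhs p2) (ctx t1), kmor t1 ∘ d21 = match_mor t2).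

Definition parallel_independent (r1 r2 : rule C)
    (tp : transformation_pair r1 r2) : Prop :=
  let t1 := trafo1 tp in let t2 := trafo2 tp in
  (exists d12 : hom (lhs r1) (ctx t2),
     kmor t2 ∘ d12 = match_mor t1 /\ sat (rule_ac r1) (cmor t2 ∘ d12)) /\
  (exists d21 : hom (lhs r2) (ctx t1),
     kmor t1 ∘ d21 = match_mor t2 /\ sat (rule_ac r2) (cmor t1 ∘ d21)).

Definition plain_conflict (p1 p2 : plain_rule C)
    (tp : transformation_pair p1 p2) : Prop := ~ plain_parallel_independent tp.

Definition parallel_dependent (r1 r2 : rule C)
    (tp : transformation_pair r1 r2) : Prop := ~ parallel_independent tp.

End Pairs.

(** ** Extension diagrams and embeddings *)

Record is_extension_diagram (C : m_adhesive_category) (p : plain_rule C)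
    (K G : C) (t : transformation p K) (t' : transformation p G) (f : hom K G)
    (d : hom (ctx t) (ctx t')) (h : hom (result t) (result t')) : Prop := {
  ext_match : f ∘ match_mor t = match_mor t';
  ext_ctx_emb : d ∘ ctx_emb t = ctx_emb t';
  ext_comatch : h ∘ comatch t = comatch t';
  ext_left_po : is_pushout (kmor t) d f (kmor t');
  ext_right_po : is_pushout (cmor t) d h (cmor t') }.

Arguments is_extension_diagram {C p K G} t t' f d h.

Definition embeds_via (C : m_adhesive_category) (p1 p2 : plain_rule C)
    (tp tp' : transformation_pair p1 p2) (f : hom (source tp) (source tp')) :
    Prop :=
  (exists d1 h1, is_extension_diagram (trafo1 tp) (trafo1 tp') f d1 h1) /\
  (exists d2 h2, is_extension_diagram (trafo2 tp) (trafo2 tp') f d2 h2).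

Arguments embeds_via {C p1 p2} tp tp' f.

Definition isomorphic_pairs (C : m_adhesive_category) (p1 p2 : plain_rule C)
    (tp tp' : transformation_pair p1 p2) : Prop :=
  exists (f : hom (source tp) (source tp')) d1 h1 d2 h2,
    [/\ is_extension_diagram (trafo1 tp) (trafo1 tp') f d1 h1,
        is_extension_diagram (trafo2 tp) (trafo2 tp') f d2 h2
      & is_iso f /\ [/\ is_iso d1, is_iso h1, is_iso d2 & is_iso h2]].

(** ** Initial transformation pairs *)

(** An embedding is identified with its extension morphism: the context
    components are determined because [kmor] is monic, the result components
    because the results are pushouts. *)
Definition is_initial_pair_for (C : m_adhesive_category) (p1 p2 : plain_rule C)
    (tpI tp : transformation_pair p1 p2) : Prop :=
  exists fI : hom (source tpI) (source tp),
    embeds_via tpI tp fI /\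
    forall (tp' : transformation_pair p1 p2) (f : hom (source tp') (source tp)),
      embeds_via tp' tp f ->
      exists! fI' : hom (source tpI) (source tp'),
        embeds_via tpI tp' fI' /\ f ∘ fI' = fI.

Definition is_plain_initial_conflict (C : m_adhesive_category)
    (p1 p2 : plain_rule C) (tp : transformation_pair p1 p2) : Prop :=
  plain_conflict tp /\
  exists tpI, is_initial_pair_for tpI tp /\ isomorphic_pairs tp tpI.

Definition has_initial_pairs_for_conflicts (C : m_adhesive_category) : Prop :=
  forall (p1 p2 : plain_rule C) (tp : transformation_pair p1 p2),
    plain_conflict tp -> exists tpI, is_initial_pair_for tpI tp.

(** ** The initial parallel independent transformation pair *)

Section InitialParallelIndependent.
Variables (C : m_adhesive_category) (cop : binary_coproducts C).

Definition csum_mapl (A B X : C) (f : hom A B) :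
    hom (csum cop A X) (csum cop B X) :=
  copair cop (cinl cop B X ∘ f) (cinr cop B X).
Definition csum_mapr (A B X : C) (f : hom A B) :
    hom (csum cop X A) (csum cop X B) :=
  copair cop (cinl cop X B) (cinr cop X B ∘ f).

Lemma copair_ext (A B X : C) (v w : hom (csum cop A B) X) :
  v ∘ cinl cop A B = w ∘ cinl cop A B ->
  v ∘ cinr cop A B = w ∘ cinr cop A B -> v = w.
Proof.
by move=> El Er; rewrite (copair_uniq v) (copair_uniq w) El Er.
Qed.

Lemma csum_mapl_po (A B X : C) (f : hom A B) :
  is_pushout f (cinl cop A X) (cinl cop B X) (csum_mapl X f).
Proof.
split=> [|Y u v Euv]; first by rewrite copair_inl.
exists (copair cop u (v ∘ cinr cop A X)); split.
  rewrite copair_inl; split=> //; apply: copair_ext;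
    by rewrite -comp_assoc ?copair_inl ?copair_inr // comp_assoc copair_inl.
move=> w [<- <-].
by rewrite [in RHS](copair_uniq w) -comp_assoc copair_inr.
Qed.

Lemma csum_mapr_po (A B X : C) (f : hom A B) :
  is_pushout f (cinr cop X A) (cinr cop X B) (csum_mapr X f).
Proof.
split=> [|Y u v Euv]; first by rewrite copair_inr.
exists (copair cop (v ∘ cinl cop X A) u); split.
  rewrite copair_inr; split=> //; apply: copair_ext;
    by rewrite -comp_assoc ?copair_inl ?copair_inr // comp_assoc copair_inr.
move=> w [<- <-].
by rewrite [in RHS](copair_uniq w) -comp_assoc copair_inl.
Qed.

Definition initial_independent_pair (p1 p2 : plain_rule C) :
    transformation_pair p1 p2 :=
  TransformationPair
    (Transformation (csum_mapl_po (lhs p2) (lmor p1))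
                    (csum_mapl_po (lhs p2) (rmor p1)))
    (Transformation (csum_mapr_po (lhs p1) (lmor p2))
                    (csum_mapr_po (lhs p1) (rmor p2))).

End InitialParallelIndependent.

(** * Translation of application conditions *)

(** Application conditions are finitary, so these translations need not exist
    in every [M]-adhesive category; each record packages an arbitrary choice of
    translated conditions, constrained only by its semantics. *)

Record shift_operation (C : m_adhesive_category) := ShiftOperation {
  shift_ac : forall P P' : C, hom P P' -> AC P -> AC P';
  shiftP : forall (P P' : C) (b : hom P P') (ac : AC P) (G : C) (n : hom P' G),
    sat (shift_ac b ac) n <-> sat ac (n ∘ b) }.

Arguments shift_ac {C} s [P P'] _ _.

Record left_operation (C : m_adhesive_category) := LeftOperation {
  left_ac : forall p : plain_rule C, AC (rhs p) -> AC (lhs p);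
  leftP : forall (p : plain_rule C) (ac : AC (rhs p)) (G : C)
      (t : transformation p G),
    sat (left_ac ac) (match_mor t) <-> sat ac (comatch t) }.

Arguments left_ac {C} l p _.

(** * Symbolic transformation pairs and initial conflicts *)

Section Symbolic.
Variables (C : m_adhesive_category).
Variables (Shift : shift_operation C) (Left : left_operation C).

Definition pair_ac (r1 r2 : rule C) (tp : transformation_pair r1 r2) :
    AC (source tp) :=
  ac_and (shift_ac Shift (match_mor (trafo1 tp)) (rule_ac r1))
         (shift_ac Shift (match_mor (trafo2 tp)) (rule_ac r2)).

(** The choice of [d] is immaterial since [kmor t2] is monic. *)
Definition conflict_ac_dir (r1 r2 : rule C) (K : C)
    (t1 : transformation r1 K) (t2 : transformation r2 K) : AC K :=
  match excluded_middle_informative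
          (exists d : hom (lhs r1) (ctx t2), kmor t2 ∘ d = match_mor t1) with
  | left ex_d =>
      let d := proj1_sig (constructive_indefinite_description _ ex_d) in
      left_ac Left (derived_span t2) (shift_ac Shift (cmor t2 ∘ d) (rule_ac r1))
  | right _ => ac_false K
  end.

Definition conflict_ac (r1 r2 : rule C) (tp : transformation_pair r1 r2) :
    AC (source tp) :=
  ac_not (ac_and (conflict_ac_dir (trafo1 tp) (trafo2 tp))
                 (conflict_ac_dir (trafo2 tp) (trafo1 tp))).

Record symbolic_pair (r1 r2 : rule C) := SymbolicPair {
  sym_pair : transformation_pair r1 r2;
  sym_ac : AC (source sym_pair);
  sym_conflict_ac : AC (source sym_pair);
  sym_acE : sym_ac = pair_ac sym_pair;
  sym_conflict_acE : sym_conflict_ac = conflict_ac sym_pair }.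

Definition in_unfolding (r1 r2 : rule C) (stp : symbolic_pair r1 r2)
    (tp : transformation_pair r1 r2) : Prop :=
  is_direct_pair tp /\
  exists f : hom (source (sym_pair stp)) (source tp),
    embeds_via (sym_pair stp) tp f.

Definition is_conflict_inducing (r1 r2 : rule C) (stp : symbolic_pair r1 r2) :
    Prop :=
  exists tp, in_unfolding stp tp /\ parallel_dependent tp.

Definition is_initial_conflict (cop : binary_coproducts C) (r1 r2 : rule C)
    (stp : symbolic_pair r1 r2) : Prop :=
  is_conflict_inducing stp /\
  (is_plain_initial_conflict (sym_pair stp) \/
   isomorphic_pairs (sym_pair stp) (initial_independent_pair cop r1 r2)).

End Symbolic.

(* Main.v *)
From mathcomp Require Import ssreflect ssrfun ssrbool seq.
From Stdlib Require Import ClassicalEpsilon.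
Require Import Defs.

Set Implicit Arguments.
Unset Strict Implicit.
Unset Printing Implicit Defensive.

(** If the given pair [tp] is already in plain conflict, its initial pair
    [tpI] embeds into it; [tpI] is again in conflict, since independence is
    preserved by embeddings, and it is initial for itself. If [tp] is plain
    independent with witnesses [d12] and [d21], the pair over [L1 + L2] embeds
    into it via the copairing of the matches: the coproduct squares are pushouts, so the
    extension squares are pushouts by decomposition. In both cases the extension
    morphism satisfies the conflict condition: each half of the negated
    conjunction yields one of the two witnesses of parallel independence, and
    [tp] is parallel dependent. *)

Local Open Scope cat_scope.

Lemma pushout_ext (C : category) (A B D E X : C) (f : hom A B) (g : hom A D)
    (h : hom B E) (k : hom D E) (v w : hom E X) :
  is_pushout f g h k -> v ∘ h = w ∘ h -> v ∘ k = w ∘ k -> v = w.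
Proof.
move=> [Esq univ] Eh Ek.
have [|y [_ uniq_y]] := univ X (w ∘ h) (w ∘ k).
  by rewrite -!comp_assoc Esq.
by rewrite -(uniq_y v) // (uniq_y w).
Qed.

Lemma pushout_idm (C : category) (A B : C) (f : hom A B) :
  is_pushout f (idm A) (idm B) f.
Proof.
split=> [|X u v]; first by rewrite comp_idl comp_idr.
rewrite comp_idr => Euv; exists u; split; first by rewrite comp_idr.
by move=> w [<- _]; rewrite comp_idr.
Qed.

Lemma pushout_paste (C : category) (A B D E D' E' : C) (f : hom A B)
    (g : hom A D) (h : hom B E) (k : hom D E) (v : hom D D') (w : hom E E')
    (k' : hom D' E') :
  is_pushout f g h k -> is_pushout k v w k' ->
  is_pushout f (v ∘ g) (w ∘ h) k'.
Proof.
move=> po1 po2; have [Esq1 univ1] := po1; have [Esq2 univ2] := po2.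
split=> [|X u z]; first by rewrite -comp_assoc Esq1 !comp_assoc Esq2.
rewrite comp_assoc => /univ1[x [[Exh Exk] _]].
have [y [[Eyw Eyk] _]] := univ2 X x z Exk.
exists y; split=> [|y' [Eh Ek]]; first by rewrite comp_assoc Eyw.
apply: (pushout_ext po2); last by rewrite Eyk Ek.
apply: (pushout_ext po1); first by rewrite Eyw Exh -Eh comp_assoc.
by rewrite -!comp_assoc Esq2 !comp_assoc Eyk Ek.
Qed.

(** A cocone [u], [z] on the right square restricts along [h] to a cocone on the outer pushout,
    which supplies the mediating morphism. That it extends [u] itself is tested on [h] and [k],
    which are jointly epic. *)
Lemma pushout_cancel (C : category) (A B D E D' E' : C) (f : hom A B)
    (g : hom A D) (h : hom B E) (k : hom D E) (v : hom D D') (w : hom E E')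
    (k' : hom D' E') :
  is_pushout f g h k -> is_pushout f (v ∘ g) (w ∘ h) k' ->
  w ∘ k = k' ∘ v -> is_pushout k v w k'.
Proof.
move=> po1 po; have [Esq1 _] := po1; have [_ univ] := po.
move=> Esq2; split=> // X u z Euz.
have [|y [[Eyh Eyk] _]] := univ X (u ∘ h) z.
  by rewrite -comp_assoc Esq1 !comp_assoc Euz.
exists y; split=> [|y' [Ew Ek]].
  split=> //; apply: (pushout_ext po1); first by rewrite -comp_assoc.
  by rewrite -comp_assoc Esq2 comp_assoc Eyk.
apply: (pushout_ext po); last by rewrite Eyk Ek.
by rewrite Eyh -Ew comp_assoc.
Qed.

Lemma is_iso_idm (C : category) (A : C) : is_iso (idm A).
Proof. by exists (idm A); rewrite comp_idl. Qed.

Section Embeddings.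
Variable C : m_adhesive_category.

Lemma extension_diagram_idm (p : plain_rule C) (K : C)
    (t : transformation p K) :
  is_extension_diagram t t (idm _) (idm _) (idm _).
Proof. by split; rewrite ?comp_idl //; apply: pushout_idm. Qed.

Lemma extension_diagram_comp (p : plain_rule C) (K G G' : C)
    (t : transformation p K) (t' : transformation p G)
    (t'' : transformation p G') f d h f' d' h' :
  is_extension_diagram t t' f d h -> is_extension_diagram t' t'' f' d' h' ->
  is_extension_diagram t t'' (f' ∘ f) (d' ∘ d) (h' ∘ h).
Proof.
move=> [Em Ed Eh pol por] [Em' Ed' Eh' pol' por'].
by split; rewrite -?comp_assoc ?Em ?Ed ?Eh //; apply: pushout_paste;
  eassumption.
Qed.

Variables p1 p2 : plain_rule C.
Implicit Types tp : transformation_pair p1 p2.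

Lemma embeds_via_idm tp : embeds_via tp tp (idm _).
Proof.
by split; do 2 exists (idm _); apply: extension_diagram_idm.
Qed.

Lemma embeds_via_comp tp tp' tp'' (f : hom (source tp) (source tp'))
    (f' : hom (source tp') (source tp'')) :
  embeds_via tp tp' f -> embeds_via tp' tp'' f' ->
  embeds_via tp tp'' (f' ∘ f).
Proof.
move=> [[d1 [h1 e1]] [d2 [h2 e2]]] [[d1' [h1' e1']] [d2' [h2' e2']]].
split; first by exists (d1' ∘ d1), (h1' ∘ h1); apply: extension_diagram_comp.
by exists (d2' ∘ d2), (h2' ∘ h2); apply: extension_diagram_comp.
Qed.

Lemma isomorphic_pairs_refl tp : isomorphic_pairs tp tp.
Proof.
exists (idm _), (idm _), (idm _), (idm _), (idm _).
by split; [apply: extension_diagram_idm.. | do !split; apply: is_iso_idm].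
Qed.

(** The witnesses are pushed forward along the context morphisms [e2] and [e1]; commutativity of the
    left extension squares suffices. *)
Lemma plain_parallel_independent_embeds tp tp'
    (f : hom (source tp) (source tp')) :
  embeds_via tp tp' f -> plain_parallel_independent tp ->
  plain_parallel_independent tp'.
Proof.
move=> [[e1 [h1 x1]] [e2 [h2 x2]]] [[d12 E12] [d21 E21]]; split.
  exists (e2 ∘ d12).
  by rewrite -(ext_match x1) comp_assoc -(ext_left_po x2).1 -comp_assoc E12.
exists (e1 ∘ d21).
by rewrite -(ext_match x2) comp_assoc -(ext_left_po x1).1 -comp_assoc E21.
Qed.

Lemma initial_pair_idem tpI tp :
  is_initial_pair_for tpI tp -> is_initial_pair_for tpI tpI.
Proof.
move=> [fI [emb_fI univ]]; exists (idm _); split; first exact: embeds_via_idm.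
move=> tp' f emb_f.
(* Initiality over [tp] only gives [fI ∘ f ∘ g = fI], and [fI] need not be monic. *)
have [g [[emb_g Eg] uniq_g]] := univ tp' _ (embeds_via_comp emb_f emb_fI).
exists g; split; last first.
  by move=> g' [emb_g' Eg']; apply: uniq_g; rewrite -comp_assoc Eg' comp_idr.
(* Both [f ∘ g] and the identity embed [tpI] into itself over [fI], so uniqueness identifies
   them. *)
split=> //; have [x [_ uniq_x]] := univ tpI fI emb_fI.
have <- : x = f ∘ g.
  by apply: uniq_x; rewrite comp_assoc; split=> //; apply: embeds_via_comp.
by apply: uniq_x; rewrite comp_idr; split=> //; apply: embeds_via_idm.
Qed.

Lemma initial_pair_plain_initial_conflict tpI tp :
  plain_conflict tp -> is_initial_pair_for tpI tp ->
  is_plain_initial_conflict tpI.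
Proof.
move=> conf init; split; last first.
  exists tpI; split; first exact: initial_pair_idem init.
  exact: isomorphic_pairs_refl.
have [f [emb _]] := init.
by move=> /(plain_parallel_independent_embeds emb).
Qed.

(** Pasting this square onto the coproduct square along [cinl] gives back the assumed pushout, so
    [pushout_cancel] applies. *)
Lemma csum_mapl_extension_po (cop : binary_coproducts C) (A B X D E : C)
    (f : hom A B) (g : hom A D) (h : hom B E) (k : hom D E) (d : hom X D) :
  is_pushout f g h k ->
  is_pushout (csum_mapl cop X f) (copair cop g d) (copair cop h (k ∘ d)) k.
Proof.
move=> po; apply: pushout_cancel (csum_mapl_po cop X f) _ _.
  by rewrite !copair_inl.
apply: (@copair_ext _ cop); rewrite -!comp_assoc.
  by rewrite !copair_inl comp_assoc copair_inl po.1.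
by rewrite !copair_inr.
Qed.

Lemma csum_mapr_extension_po (cop : binary_coproducts C) (A B X D E : C)
    (f : hom A B) (g : hom A D) (h : hom B E) (k : hom D E) (d : hom X D) :
  is_pushout f g h k ->
  is_pushout (csum_mapr cop X f) (copair cop d g) (copair cop (k ∘ d) h) k.
Proof.
move=> po; apply: pushout_cancel (csum_mapr_po cop X f) _ _.
  by rewrite !copair_inr.
apply: (@copair_ext _ cop); rewrite -!comp_assoc.
  by rewrite !copair_inl.
by rewrite !copair_inr comp_assoc copair_inr po.1.
Qed.

Lemma initial_independent_pair_embeds (cop : binary_coproducts C) tp :
  plain_parallel_independent tp ->
  embeds_via (initial_independent_pair cop p1 p2) tp
    (copair cop (match_mor (trafo1 tp)) (match_mor (trafo2 tp))).
Proof.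
case: tp => G t1 t2 [/= [d12 E12] [d21 E21]]; split.
  (* The context of the first step over the coproduct is the interface of [p1] plus all of [lhs p2];
     [d21] is what places the second summand inside [ctx t1]. *)
  exists (copair cop (ctx_emb t1) d21).
  exists (copair cop (comatch t1) (cmor t1 ∘ d21)).
  split=> /=; rewrite ?copair_inl // -?E21; apply: csum_mapl_extension_po.
    exact: left_po.
  exact: right_po.
exists (copair cop d12 (ctx_emb t2)).
exists (copair cop (cmor t2 ∘ d12) (comatch t2)).
split=> /=; rewrite ?copair_inr // -?E12; apply: csum_mapr_extension_po.
  exact: left_po.
exact: right_po.
Qed.

End Embeddings.

Section Completeness.
Variables (C : m_adhesive_category).
Variables (Shift : shift_operation C) (Left : left_operation C).

(* The extension diagram of [t2] is itself a double pushout via the span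
   derived from [t2], with match [f]; this is what makes [leftP] applicable. *)
Lemma conflict_ac_dir_sat (r1 r2 : rule C) (K G : C)
    (t1 : transformation r1 K) (t2 : transformation r2 K)
    (t1' : transformation r1 G) (t2' : transformation r2 G)
    (f : hom K G) d2 h2 :
  f ∘ match_mor t1 = match_mor t1' ->
  is_extension_diagram t2 t2' f d2 h2 ->
  sat (conflict_ac_dir Shift Left t1 t2) f ->
  exists d : hom (lhs r1) (ctx t2'),
    kmor t2' ∘ d = match_mor t1' /\ sat (rule_ac r1) (cmor t2' ∘ d).
Proof.
move=> Ef ext; rewrite /conflict_ac_dir.
(* If no [d] exists, the condition is [ac_false], which no morphism satisfies. *)
case: excluded_middle_informative => [ex_d|_] /=; last by case.
case: constructive_indefinite_description => d /= Ed.
set t : transformation (derived_span t2) G :=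
  @Transformation _ (derived_span t2) _ _ _ _ _ _ _ _
    (ext_left_po ext) (ext_right_po ext).
move=> /(leftP Left _ t) /shiftP /= sat_h.
(* The comatch of [t] is [h2], so [sat_h] concerns [h2 ∘ (cmor t2 ∘ d)]; the right extension square
   turns this into [cmor t2' ∘ (d2 ∘ d)]. *)
exists (d2 ∘ d); rewrite !comp_assoc -(ext_left_po ext).1.
by rewrite -(ext_right_po ext).1 -!comp_assoc Ed.
Qed.

Lemma embeds_via_sat (r1 r2 : rule C) (tpK tp : transformation_pair r1 r2)
    (m : hom (source tpK) (source tp)) :
  embeds_via tpK tp m -> is_direct_pair tp -> parallel_dependent tp ->
  sat (ac_and (pair_ac Shift tpK) (conflict_ac Shift Left tpK)) m.
Proof.
move=> [[d1 [h1 x1]] [d2 [h2 x2]]] [dir1 dir2] dep; split.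
  by split; [| split=> //]; apply/shiftP;
    rewrite ?(ext_match x1) ?(ext_match x2).
split=> // -[sat12 [sat21 _]]; apply: dep; split.
  exact: conflict_ac_dir_sat (ext_match x1) x2 sat12.
exact: conflict_ac_dir_sat (ext_match x2) x1 sat21.
Qed.

End Completeness.

Theorem theorem6 (C : m_adhesive_category)
    (E' : pair_class C) (E'_fact : has_unique_pair_factorization E')
    (cop : binary_coproducts C)
    (initC : has_initial_pairs_for_conflicts C)
    (Shift : shift_operation C) (Left : left_operation C)
    (r1 r2 : rule C) (tp : transformation_pair r1 r2)
    (tp_direct : is_direct_pair tp) (tp_dep : parallel_dependent tp) :
  exists stp : symbolic_pair Shift Left r1 r2,
    is_initial_conflict cop stp /\
    exists m : hom (source (sym_pair stp)) (source tp),
      sat (ac_and (sym_ac stp) (sym_conflict_ac stp)) m /\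
      embeds_via (sym_pair stp) tp m.
Proof.
have [tpK [initK [m emb_m]]] : exists tpK : transformation_pair r1 r2,
    (is_plain_initial_conflict tpK \/
     isomorphic_pairs tpK (initial_independent_pair cop r1 r2)) /\
    exists m, embeds_via tpK tp m.
  (* In the plain independent case, the dependence of [tp] stems from the application conditions
     alone. *)
  have [indep | conf] := excluded_middle_informative
    (plain_parallel_independent tp).
    exists (initial_independent_pair cop r1 r2); split.
      by right; apply: isomorphic_pairs_refl.
    by eexists; apply: initial_independent_pair_embeds indep.
  have [tpI initI] := initC _ _ _ conf.
  exists tpI; split; last by case: initI => f [emb _]; exists f.
  by left; apply: initial_pair_plain_initial_conflict conf initI.
exists (@SymbolicPair _ Shift Left _ _ tpK _ _ erefl erefl); split.
  (* The given pair [tp] itself is the parallel dependent member of the unfolding. *)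
  by split=> //; exists tp; do 2?split=> //; exists m.
by exists m; split=> //; apply: embeds_via_sat.
Qed.
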